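(* Let $F:\mathbb{R}^n\to\mathbb{R}$ be continuous, bounded below, and differentiable with locally Lipschitz continuous gradient $\dot F$. Let the algorithm described in the context be applied to $F$ from an arbitrary $\theta_0\in\mathbb{R}^n$, and let $\{\ell_t:t+1\in\mathbb{N}\}$ be the indices of accepted iterates defined in the context. Then one of the following occurs. 1. There exists $t\in\{0,1,2,\ldots\}$ such that $\ell_t<\infty$, $F(\theta_{\ell_t})\le F(\theta_0)$ and $\dot F(\theta_{\ell_t})=0$. 2. All $\ell_t$ are finite, $\liminf_{k\to\infty}\delta_k>0$, and $\lim_{k\to\infty}\|\dot F(\theta_k)\|_2=0$. 3. All $\ell_t$ are finite, $\liminf_{k\to\infty}\delta_k=0$, and there exists a subsequence (infinite subset) $\mathcal{T}\subseteq\mathbb{N}$ such that $$\sum_{t\in\mathcal{T}}\frac{\|\dot F(\theta_{\ell_{t-1}})\|_2^2}{\mathcal{L}(C_{\ell_{t-1}})}<\infty,$$ where $C_k$ and $\mathcal{L}(C_k)$ are as defined in the context.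
   Context: Algorithm. $F:\mathbb{R}^n\to\mathbb{R}$ is differentiable with gradient $\dot F$. Inputs: $\theta_0\in\mathbb{R}^n$, $\rho\in(0,1)$, $\overline\delta\in(0,\infty)$, $\delta_0\in(0,\overline\delta]$. Set $\tau_{\mathrm{low}}^0=\|\dot F(\theta_0)\|_2/\sqrt2$ and $\tau_{\mathrm{upp}}^0=\sqrt{10}\,\|\dot F(\theta_0)\|_2$. For outer iterations $k=0,1,2,\ldots$: if $\dot F(\theta_k)=0$, terminate. Otherwise set $\psi_0^k=\theta_k$, $j=0$, and run the inner loop: (i) Compute $\hat L_j^k$: $\hat L_0^0=1$; $\hat L_0^k=\hat L_{j_{k-1}}^{k-1}$ for $k>0$; and for $j>0$, with $q=\|\dot F(\psi_j^k)-\dot F(\psi_{j-1}^k)\|_2/\|\psi_j^k-\psi_{j-1}^k\|_2$, set $\hat L_j^k=q$ if $k=0$ or $\theta_k\ne\theta_{k-1}$, and $\hat L_j^k=\max(q,\hat L_{j-1}^k)$ if $k>0$ and $\theta_k=\theta_{k-1}$. (ii) With $g=\|\dot F(\psi_j^k)\|_2$, set $C_{j,1}^k=g^3+\tfrac12 g^2\hat L_j^k+10^{-16}$, $C_{j,2}^k=g+\tfrac12\hat L_j^k+10^{-16}$, and $\alpha_j^k=\min\big((\tau_{\mathrm{low}}^k)^2/C_{j,1}^k,\ 1/C_{j,2}^k\big)+10^{-16}$. (iii) Check whether a triggering event occurs: $\|\psi_j^k-\theta_k\|_2>10$, or $\|\dot F(\psi_j^k)\|_2\notin(\tau_{\mathrm{low}}^k,\tau_{\mathrm{upp}}^k)$,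 or $j=100$. If none occurs, set $\psi_{j+1}^k=\psi_j^k-\delta_k\alpha_j^k\dot F(\psi_j^k)$, replace $j$ by $j+1$, and return to (i). If one occurs, set $j_k=j$ (one has $0<j_k\le100$), exit the inner loop, and update as follows: - (reject) if $F(\psi_{j_k}^k)\ge F(\theta_k)-\rho\delta_k\alpha_0^k\|\dot F(\theta_k)\|_2^2$: $\theta_{k+1}=\theta_k$, $\delta_{k+1}=\tfrac12\delta_k$, thresholds unchanged; - (accept) else if $\|\dot F(\psi_{j_k}^k)\|_2\le\tau_{\mathrm{low}}^k$: $\theta_{k+1}=\psi_{j_k}^k$, $\delta_{k+1}=\delta_k$, $\tau_{\mathrm{low}}^{k+1}=\|\dot F(\theta_{k+1})\|_2/\sqrt2$, $\tau_{\mathrm{upp}}^{k+1}=\sqrt{20}\,\tau_{\mathrm{low}}^{k+1}$; - (accept) else if $\|\dot F(\psi_{j_k}^k)\|_2\ge\tau_{\mathrm{upp}}^k$: $\theta_{k+1}=\psi_{j_k}^k$, $\delta_{k+1}=\min\{1.5\,\delta_k,\overline\delta\}$, $\tau_{\mathrm{low}}^{k+1}=\|\dot F(\theta_{k+1})\|_2/\sqrt2$, $\tau_{\mathrm{upp}}^{k+1}=\sqrt{20}\,\tau_{\mathrm{low}}^{k+1}$; - (accept) else: $\theta_{k+1}=\psi_{j_k}^k$, $\delta_{k+1}=\min\{1.5\,\delta_k,\overline\delta\}$, thresholds unchanged. If the algorithm terminates at outer iteration $K$, put $\theta_k=\theta_K$ and $\delta_k=\delta_K$ for $k\ge K$. Accepted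 iterates: $\ell_0=0$ and $\ell_t=\min\{k>\ell_{t-1}:\theta_k\ne\theta_{\ell_{t-1}}\}$ for $t\in\mathbb{N}$, with $\ell_t=\infty$ if no such finite $k$ exists or if $\ell_{t-1}=\infty$. Compact sets: with $\overline\alpha=10^{-16}+10^{16}$ and $\mathcal{G}(\theta)=\sup\{\|\dot F(\psi)\|_2:\|\psi-\theta\|_2\le10\}$, let $C_k=\{\psi\in\mathbb{R}^n:\|\psi-\theta_k\|_2\le10+\delta_k\overline\alpha\,\mathcal{G}(\theta_k)\}$. $\mathcal{L}(C_k)>0$ denotes a (positive) Lipschitz constant of $\dot F$ on $C_k$. A function is locally Lipschitz continuous if every point has an open ball around it on which the function is Lipschitz continuous (hence it is Lipschitz on every compact set). *)

(* Defs.v *)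
From mathcomp Require Export all_boot all_order all_algebra.
From mathcomp Require Export all_classical all_reals all_analysis.
Export Order.TTheory GRing.Theory Num.Theory.
Export numFieldNormedType.Exports.

Set Implicit Arguments.
Unset Strict Implicit.
Unset Printing Implicit Defensive.

Local Open Scope classical_set_scope.
Local Open Scope ring_scope.

(* The library norm on 'rV[R]_n is the max norm; lengths and Lipschitz
   constants below are Euclidean.  The notions used directly from the library
   (continuous, differentiable) depend only on the topology, which is the same
   for both norms. *)
Definition norm2 (R : realType) (n : nat) (x : 'rV[R]_n) : R :=
  Num.sqrt (\sum_(i < n) x ord0 i ^+ 2).

Definition grad (R : realType) (n : nat) (F : 'rV[R]_n -> R) (x : 'rV[R]_n) :
    'rV[R]_n :=
  \row_(i < n) 'D_(delta_mx ord0 i) F x.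

Definition lipschitz2_on (R : realType) (n : nat) (L : R) (A : set 'rV[R]_n)
    (G : 'rV[R]_n -> 'rV[R]_n) : Prop :=
  forall x y, A x -> A y -> norm2 (G x - G y) <= L * norm2 (x - y).

Definition locally_lipschitz2 (R : realType) (n : nat)
    (G : 'rV[R]_n -> 'rV[R]_n) : Prop :=
  forall x, exists r L : R,
    0 < r /\ lipschitz2_on L [set y | norm2 (y - x) < r] G.

(* State at the start of outer iteration k: the iterate theta_k, the previous
   iterate theta_{k-1} (None when k = 0), delta_k, the two thresholds, and the
   local Lipschitz estimate with inner index 0. *)
Record outer_state (R : realType) (n : nat) := OuterState {
  iter_theta : 'rV[R]_n;
  iter_prev : option 'rV[R]_n;
  iter_delta : R;
  tau_low : R;
  tau_upp : R;
  iter_Lhat0 : R }.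

Definition C1 (R : realType) (g L : R) : R :=
  g ^+ 3 + 2^-1 * g ^+ 2 * L + 10 ^- 16.

Definition C2 (R : realType) (g L : R) : R := g + 2^-1 * L + 10 ^- 16.

Definition step_size (R : realType) (tlow g L : R) : R :=
  Num.min (tlow ^+ 2 / C1 g L) (1 / C2 g L) + 10 ^- 16.

(* An inner state is the pair of the point psi_j^k and the estimate of the
   Lipschitz constant at inner index j. *)
Definition inner_step (R : realType) (n : nat) (F : 'rV[R]_n -> R)
    (s : outer_state R n) (p : 'rV[R]_n * R) : 'rV[R]_n * R :=
  let psi := p.1 in
  let L := p.2 in
  let alpha := step_size (tau_low s) (norm2 (grad F psi)) L in
  let psi' := psi - (iter_delta s * alpha) *: grad F psi in
  let q := norm2 (grad F psi' - grad F psi) / norm2 (psi' - psi) in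
  (psi', if iter_prev s == Some (iter_theta s) then Num.max q L else q).

(* The recursion is unfolded for every j; only the values up to the first
   triggering index [inner_stop] are ever used. *)
Definition inner_state (R : realType) (n : nat) (F : 'rV[R]_n -> R)
    (s : outer_state R n) (j : nat) : 'rV[R]_n * R :=
  iter j (inner_step F s) (iter_theta s, iter_Lhat0 s).

Definition trigger (R : realType) (n : nat) (F : 'rV[R]_n -> R)
    (s : outer_state R n) (j : nat) : bool :=
  let psi := (inner_state F s j).1 in
  [|| 10 < norm2 (psi - iter_theta s),
      ~~ (tau_low s < norm2 (grad F psi) < tau_upp s) | j == 100%N].

(* [find] returns the position of the first success in 0, 1, ..., 100, and a
   success exists since 100 itself triggers. *)
Definition inner_stop (R : realType) (n : nat) (F : 'rV[R]_n -> R)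
    (s : outer_state R n) : nat :=
  find (trigger F s) (iota 0 101).

Definition outer_init (R : realType) (n : nat) (F : 'rV[R]_n -> R)
    (delta0 : R) (theta0 : 'rV[R]_n) : outer_state R n :=
  let g := norm2 (grad F theta0) in
  OuterState theta0 None delta0 (g / Num.sqrt 2) (Num.sqrt 10 * g) 1.

(* Once the gradient vanishes the state is frozen, so that theta_k and delta_k
   are constant after termination. *)
Definition outer_step (R : realType) (n : nat) (F : 'rV[R]_n -> R)
    (rho deltabar : R) (s : outer_state R n) : outer_state R n :=
  let theta := iter_theta s in
  let delta := iter_delta s in
  let g := norm2 (grad F theta) in
  if grad F theta == 0 then s else
  let psi := (inner_state F s (inner_stop F s)).1 in
  let L := (inner_state F s (inner_stop F s)).2 in
  let alpha0 := step_size (tau_low s) g (iter_Lhat0 s) in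
  let gpsi := norm2 (grad F psi) in
  let low' := gpsi / Num.sqrt 2 in
  let upp' := Num.sqrt 20 * low' in
  let larger := Num.min (3 / 2 * delta) deltabar in
  if F psi >= F theta - rho * delta * alpha0 * g ^+ 2 then
    OuterState theta (Some theta) (2^-1 * delta) (tau_low s) (tau_upp s) L
  else if gpsi <= tau_low s then
    OuterState psi (Some theta) delta low' upp' L
  else if gpsi >= tau_upp s then
    OuterState psi (Some theta) larger low' upp' L
  else
    OuterState psi (Some theta) larger (tau_low s) (tau_upp s) L.

Definition outer (R : realType) (n : nat) (F : 'rV[R]_n -> R)
    (rho deltabar delta0 : R) (theta0 : 'rV[R]_n) (k : nat) : outer_state R n :=
  iter k (outer_step F rho deltabar) (outer_init F delta0 theta0).

Definition theta (R : realType) (n : nat) (F : 'rV[R]_n -> R)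
    (rho deltabar delta0 : R) (theta0 : 'rV[R]_n) (k : nat) : 'rV[R]_n :=
  iter_theta (outer F rho deltabar delta0 theta0 k).

Definition delta (R : realType) (n : nat) (F : 'rV[R]_n -> R)
    (rho deltabar delta0 : R) (theta0 : 'rV[R]_n) (k : nat) : R :=
  iter_delta (outer F rho deltabar delta0 theta0 k).

(* The least k > l with th k != th l; None stands for infinity. *)
Definition next_change (R : realType) (n : nat) (th : nat -> 'rV[R]_n)
    (l : nat) : option nat :=
  match pselect (exists k, (l < k)%N && (th k != th l)) with
  | left ex => Some (ex_minn ex)
  | right _ => None
  end.

Fixpoint accepted (R : realType) (n : nat) (th : nat -> 'rV[R]_n) (t : nat) :
    option nat :=
  match t with
  | 0 => Some 0%N
  | t'.+1 => obind (next_change th) (accepted th t')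
  end.

Definition alphabar (R : realType) : R := 10 ^- 16 + 10 ^+ 16.

Definition gradsup (R : realType) (n : nat) (F : 'rV[R]_n -> R)
    (x : 'rV[R]_n) : R :=
  sup [set norm2 (grad F psi) | psi in [set psi | norm2 (psi - x) <= 10]].

Definition Cset (R : realType) (n : nat) (F : 'rV[R]_n -> R)
    (x : 'rV[R]_n) (d : R) : set 'rV[R]_n :=
  [set psi | norm2 (psi - x) <= 10 + d * alphabar R * gradsup F x].

(* Main.v *)
(* Every step size lies in [10^-16, alphabar], so all inner iterates of outer
   iteration k stay in C_k, and by the descent lemma a trial point is accepted
   as soon as delta_k * alphabar * L(C_k) < 2 (1 - rho).  Hence at a fixed
   iterate only finitely many rejections occur, and acceptance at k decreases F
   by at least rho * 10^-16 * delta_k * |grad F(theta_k)|^2.  If delta_k stays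
   away from 0, these decreases force the gradient to 0.  Otherwise infinitely
   many accepted iterates are preceded by a rejection at the same point, at
   which delta is at least (1 - rho) / (alphabar * L(C)); the decreases over
   those indices telescope to the required convergent series. *)

Require Import Defs.
From mathcomp Require Import ring lra.

Set Implicit Arguments.
Unset Strict Implicit.
Unset Printing Implicit Defensive.

Local Open Scope classical_set_scope.
Local Open Scope ring_scope.

(** * Euclidean inner product and norm *)

Definition dot (R : realType) (n : nat) (x y : 'rV[R]_n) : R :=
  \sum_(i < n) x ord0 i * y ord0 i.

Lemma norm2_ge0 (R : realType) (n : nat) (x : 'rV[R]_n) : 0 <= norm2 x.
Proof. exact: sqrtr_ge0. Qed.

Lemma norm2_sqr (R : realType) (n : nat) (x : 'rV[R]_n) :
  norm2 x ^+ 2 = dot x x.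
Proof.
rewrite /norm2 sqr_sqrtr; last by apply: sumr_ge0 => i _; exact: sqr_ge0.
by apply: eq_bigr => i _; rewrite expr2.
Qed.

Lemma dotDl (R : realType) (n : nat) (x y z : 'rV[R]_n) :
  dot (x + y) z = dot x z + dot y z.
Proof. by rewrite -big_split; apply: eq_bigr => i _; rewrite mxE mulrDl. Qed.

Lemma dotZl (R : realType) (n : nat) (a : R) (x y : 'rV[R]_n) :
  dot (a *: x) y = a * dot x y.
Proof. by rewrite /dot big_distrr; apply: eq_bigr => i _; rewrite mxE /= mulrA. Qed.

Lemma dotBl (R : realType) (n : nat) (x y z : 'rV[R]_n) :
  dot (x - y) z = dot x z - dot y z.
Proof. by rewrite -scaleN1r dotDl dotZl mulN1r. Qed.

Lemma dotC (R : realType) (n : nat) (x y : 'rV[R]_n) : dot x y = dot y x.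
Proof. by apply: eq_bigr => i _; rewrite mulrC. Qed.

Lemma norm2_eq0 (R : realType) (n : nat) (x : 'rV[R]_n) :
  (norm2 x == 0) = (x == 0).
Proof.
rewrite -sqrf_eq0 norm2_sqr psumr_eq0; last first.
  by move=> i _; rewrite -expr2 sqr_ge0.
apply/idP/eqP => [/allP x0|->]; last by apply/allP => i _; rewrite mxE mul0r /=.
apply/rowP => i; have := x0 i (mem_index_enum i).
by rewrite /= mulf_eq0 orbb mxE => /eqP.
Qed.

Lemma norm2_0 (R : realType) (n : nat) : norm2 (0 : 'rV[R]_n) = 0.
Proof. by apply/eqP; rewrite norm2_eq0. Qed.

Lemma norm2_gt0 (R : realType) (n : nat) (x : 'rV[R]_n) :
  (0 < norm2 x) = (x != 0).
Proof. by rewrite lt_def norm2_ge0 andbT norm2_eq0. Qed.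

Lemma norm2Z (R : realType) (n : nat) (a : R) (x : 'rV[R]_n) :
  norm2 (a *: x) = `|a| * norm2 x.
Proof.
apply/eqP; rewrite -(@eqrXn2 _ 2) ?norm2_ge0 ?mulr_ge0 ?norm2_ge0//.
by rewrite norm2_sqr dotZl dotC dotZl exprMn norm2_sqr real_normK ?num_real// mulrA.
Qed.

Lemma norm2N (R : realType) (n : nat) (x : 'rV[R]_n) : norm2 (- x) = norm2 x.
Proof. by rewrite -scaleN1r norm2Z normrN1 mul1r. Qed.

Lemma dot_le_norm2 (R : realType) (n : nat) (x y : 'rV[R]_n) :
  dot x y <= norm2 x * norm2 y.
Proof.
have [->|x0] := eqVneq x 0.
  by rewrite /dot big1 ?mulr_ge0 ?norm2_ge0// => i _; rewrite mxE mul0r.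
have [->|y0] := eqVneq y 0.
  by rewrite /dot big1 ?mulr_ge0 ?norm2_ge0// => i _; rewrite mxE mulr0.
set a := norm2 x; set b := norm2 y.
have a0 : 0 < a by rewrite norm2_gt0.
have b0 : 0 < b by rewrite norm2_gt0.
(* The square of |b x - a y| expands to 2ab (ab - <x,y>), and 2ab is positive. *)
have := sqr_ge0 (norm2 (b *: x + (- a) *: y)).
rewrite norm2_sqr dotDl !dotZl ![dot _ (_ + _)]dotC !dotDl !dotZl.
rewrite -!norm2_sqr (dotC y x) -/a -/b => h.
have : 0 <= (2 * a * b) * (a * b - dot x y) by nra.
by rewrite pmulr_rge0 ?subr_ge0//; apply: mulr_gt0 => //; apply: mulr_gt0.
Qed.

Lemma ler_norm2D (R : realType) (n : nat) (x y : 'rV[R]_n) :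
  norm2 (x + y) <= norm2 x + norm2 y.
Proof.
rewrite -ler_sqr ?nnegrE ?addr_ge0 ?norm2_ge0//.
rewrite norm2_sqr dotDl ![dot _ (_ + _)]dotC !dotDl -!norm2_sqr (dotC y x).
have := dot_le_norm2 x y; lra.
Qed.

(** * Derivatives along lines and the descent lemma *)

Lemma deriveE_grad (R : realType) (n : nat) (F : 'rV[R]_n -> R)
    (x d : 'rV[R]_n) :
  differentiable F x -> 'D_d F x = dot (grad F x) d.
Proof.
move=> dF; rewrite deriveE// [X in 'd F x X](row_sum_delta d) linear_sum.
by apply: eq_bigr => i _; rewrite linearZ /= -deriveE// mxE mulrC.
Qed.

Lemma is_derive_line (R : realType) (n : nat) (F : 'rV[R]_n -> R)
    (x d : 'rV[R]_n) (t : R) :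
  differentiable F (x + t *: d) ->
  is_derive t 1 (fun s : R => F (x + s *: d)) (dot (grad F (x + t *: d)) d).
Proof.
move=> dF; have dv := @diff_derivable _ _ _ _ _ d dF.
have e h : ((fun s : R => F (x + s *: d)) \o shift t) (h *: 1) - F (x + t *: d)
   = (F \o shift (x + t *: d)) (h *: d) - F (x + t *: d).
  by rewrite /= scalerDl /GRing.scale /= mulr1 addrCA [x + _]addrC.
rewrite -deriveE_grad//; split.
  by move: dv; rewrite /derivable; under eq_fun do rewrite -e.
by rewrite /derive; under eq_fun do rewrite e.
Qed.

Lemma descent_step (R : realType) (n : nat) (F : 'rV[R]_n -> R)
    (x : 'rV[R]_n) (L s : R) (A : set 'rV[R]_n) :
  (forall y, differentiable F y) -> lipschitz2_on L A (grad F) -> 0 <= s ->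
  (forall t, 0 <= t <= 1 -> A (x - (t * s) *: grad F x)) ->
  F (x - s *: grad F x)
    <= F x - s * norm2 (grad F x) ^+ 2 * (1 - s * L / 2).
Proof.
move=> dF lip s0 segA; set g := grad F x; set N := norm2 g ^+ 2.
pose d := - s *: g.
(* This replaces the usual integral: h is F along the segment minus its quadratic upper model, up to
   a constant. The Lipschitz bound makes h' <= 0 on the open interval, and h 1 <= h 0 is the
   claim. *)
pose h (t : R) := F (x + t *: d) + (t * (s * N) - t ^+ 2 / 2 * (s ^+ 2 * L * N)).
have dh (t : R) : is_derive t (1 : R) h
    (dot (grad F (x + t *: d)) d + (s * N - t * (s ^+ 2 * L * N))).
  have d1 := is_derive_line (dF (x + t *: d)).
  apply: is_deriveD.
  apply: is_derive_eq.
  by rewrite /GRing.scale /=; field.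
have h10 : h 1 <= h 0.
  apply: (@ler0_derive1_le_cc _ h 0 1); rewrite ?in_itv/= ?lexx ?ler01//.
  - move=> t; rewrite in_itv/= => /andP[t0 t1].
    rewrite derive1E; have [_ ->] := dh t.
    have ht : 0 <= t <= 1 by rewrite !ltW.
    have xA : A x.
      by have := segA 0; rewrite mul0r scale0r subr0; apply; rewrite lexx ler01.
    have := lip _ x (segA t ht) xA.
    rewrite -/g (_ : x - (t * s) *: g - x = - (t * s) *: g); last first.
      by rewrite scaleNr addrAC subrr add0r.
    rewrite (_ : x + t *: d = x - (t * s) *: g); last first.
      by rewrite /d scalerA mulrN scaleNr.
    set G := grad F _; rewrite norm2Z normrN ger0_norm ?mulr_ge0 ?(ltW t0)// => lp.
    have := dot_le_norm2 (g - G) g.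
    rewrite dotBl -norm2_sqr -/N => cs.
    rewrite /d dotC dotZl dotC.
    have nl : norm2 (g - G) * norm2 g <= L * (t * s) * N.
      rewrite /N expr2 !mulrA ler_wpM2r ?norm2_ge0//.
      by rewrite -norm2N opprB (le_trans lp)// !mulrA.
    have k : N - dot G g <= L * (t * s) * N by exact: le_trans cs nl.
    have := ler_wpM2l s0 k; lra.
  - apply: derivable_within_continuous => t _; exact: ex_derive.
move: h10; rewrite /h /d !scale1r !scale0r addr0 scaleNr; lra.
Qed.

(** * Bounds on the step sizes and on the sets C_k *)

Lemma step_size_ge (R : realType) (tlow g L : R) :
  0 <= g -> 0 <= L -> 10 ^- 16 <= step_size tlow g L.
Proof.
move=> g0 L0; rewrite /step_size lerDr le_min /C1 /C2.
by rewrite !divr_ge0 ?sqr_ge0 ?addr_ge0 ?mulr_ge0 ?exprn_ge0 ?invr_ge0.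
Qed.

(** The summand 10^-16 inside [C2] caps 1 / [C2] at 10^16; the 10^-16 added to the minimum gives the
    rest of [alphabar]. *)
Lemma step_size_le (R : realType) (tlow g L : R) :
  0 <= g -> 0 <= L -> step_size tlow g L <= alphabar R.
Proof.
move=> g0 L0; rewrite /step_size /alphabar addrC lerD2l ge_min; apply/orP; right.
have e0 : 0 < 10 ^- 16 :> R by rewrite invr_gt0 exprn_gt0.
have C20 : 10 ^- 16 <= C2 g L by rewrite /C2 lerDr addr_ge0// mulr_ge0.
rewrite div1r -[leRHS]invrK lef_pV2 ?posrE//; exact: lt_le_trans e0 C20.
Qed.

Lemma alphabar_gt0 (R : realType) : 0 < alphabar R.
Proof. by rewrite addr_gt0 ?invr_gt0 ?exprn_gt0. Qed.

Lemma gradsup_ge0 (R : realType) (n : nat) (F : 'rV[R]_n -> R) (x : 'rV[R]_n) :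
  0 <= gradsup F x.
Proof.
rewrite /gradsup; set E := [set _ | _ in _].
(* If the gradient norms are unbounded on the ball, [sup] takes its default value 0. *)
have [[_ ubE]|/sup_out ->//] := pselect (has_sup E).
apply: le_trans (norm2_ge0 (grad F x)) (ub_le_sup ubE _).
by exists x => //=; rewrite subrr norm2_0.
Qed.

Lemma Cset_ball (R : realType) (n : nat) (F : 'rV[R]_n -> R)
    (x y : 'rV[R]_n) (d : R) :
  0 <= d -> norm2 (y - x) <= 10 -> Cset F x d y.
Proof.
move=> d0 xy; rewrite /Cset /= (le_trans xy)// lerDl.
by rewrite !mulr_ge0 ?gradsup_ge0 ?(ltW (alphabar_gt0 R)).
Qed.

Lemma subset_Cset (R : realType) (n : nat) (F : 'rV[R]_n -> R)
    (x : 'rV[R]_n) (d d' : R) : d <= d' -> Cset F x d `<=` Cset F x d'.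
Proof.
move=> dd' y /= /le_trans; apply.
by rewrite lerD2l !ler_wpM2r ?gradsup_ge0 ?(ltW (alphabar_gt0 R)).
Qed.

Lemma lipschitz2_onS (R : realType) (n : nat) (L : R) (A B : set 'rV[R]_n)
    (G : 'rV[R]_n -> 'rV[R]_n) :
  A `<=` B -> lipschitz2_on L B G -> lipschitz2_on L A G.
Proof. by move=> AB lip x y /AB Bx /AB By; exact: lip. Qed.

(* The supremum [gradsup] would be the junk value 0 if it were infinite; the
   Lipschitz bound on [Cset], which always contains the ball of radius 10,
   excludes this. *)
Lemma norm2_grad_le_gradsup (R : realType) (n : nat) (F : 'rV[R]_n -> R)
    (x y : 'rV[R]_n) (d L : R) :
  0 <= d -> 0 <= L -> lipschitz2_on L (Cset F x d) (grad F) ->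
  norm2 (y - x) <= 10 -> norm2 (grad F y) <= gradsup F x.
Proof.
move=> d0 L0 lip xy; apply: ub_le_sup; last by exists y.
exists (norm2 (grad F x) + L * 10) => _ [z /= xz <-].
rewrite -[grad F z](subrK (grad F x)) (le_trans (ler_norm2D _ _))// addrC lerD2l.
apply: le_trans (ler_wpM2l L0 xz); apply: lip; apply: Cset_ball => //.
by rewrite subrr norm2_0.
Qed.

(** * The inner loop *)

(** Invariant of the outer loop. The strict threshold inequalities prevent a trigger at j = 0; they
    are asked only at a nonzero gradient, because thresholds computed from a zero gradient are both
    0. *)
Definition well_formed (R : realType) (n : nat) (F : 'rV[R]_n -> R)
    (deltabar : R) (s : outer_state R n) : Prop :=
  [/\ 0 <= iter_Lhat0 s, 0 < iter_delta s, iter_delta s <= deltabar &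
      grad F (iter_theta s) != 0 ->
      tau_low s < norm2 (grad F (iter_theta s)) < tau_upp s].

Lemma inner_Lhat_ge0 (R : realType) (n : nat) (F : 'rV[R]_n -> R)
    (s : outer_state R n) (j : nat) :
  0 <= iter_Lhat0 s -> 0 <= (inner_state F s j).2.
Proof.
move=> L0; rewrite /inner_state; elim: j => //= j IH.
by case: ifP => _; rewrite ?le_max divr_ge0 ?norm2_ge0.
Qed.

(** At j = 0 the displacement is 0, the gradient norm lies strictly between the thresholds, and j is
    not 100, so none of the three events occurs. *)
Lemma inner_stop_gt0 (R : realType) (n : nat) (F : 'rV[R]_n -> R)
    (deltabar : R) (s : outer_state R n) :
  well_formed F deltabar s -> grad F (iter_theta s) != 0 ->
  (0 < inner_stop F s)%N.
Proof.
move=> [_ _ _ tau] g0; rewrite lt0n; apply/negP => /eqP stop0.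
have ht : has (trigger F s) (iota 0 101).
  by rewrite has_find -/(inner_stop F s) stop0 size_iota.
have := nth_find 0%N ht; rewrite -/(inner_stop F s) stop0 nth_iota//.
rewrite /trigger addn0 /inner_state [iter _ _ _]/= tau//= subrr orbF.
by rewrite norm2_0 ltNge ler0n.
Qed.

Lemma inner_ball (R : realType) (n : nat) (F : 'rV[R]_n -> R)
    (s : outer_state R n) (j : nat) :
  (j < inner_stop F s)%N ->
  norm2 ((inner_state F s j).1 - iter_theta s) <= 10.
Proof.
move=> js; have j101 : (j < 101)%N.
  by apply: leq_trans js _; rewrite -[101%N](size_iota 0); exact: find_size.
have := before_find 0%N js; rewrite nth_iota// add0n.
by rewrite /trigger => /negbT; rewrite !negb_or -leNgt => /andP[].
Qed.

(** This is [descent_step] with s = delta * alpha; in the last factor alpha is then enlarged to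
    [alphabar], so that the factor is the same for all j. *)
Lemma inner_step_descent (R : realType) (n : nat) (F : 'rV[R]_n -> R)
    (deltabar L : R) (s : outer_state R n) (j : nat) :
  let p := inner_state F s j in
  let g := norm2 (grad F p.1) in
  (forall y, differentiable F y) -> well_formed F deltabar s -> 0 <= L ->
  lipschitz2_on L (Cset F (iter_theta s) (iter_delta s)) (grad F) ->
  (j < inner_stop F s)%N ->
  F (inner_state F s j.+1).1
    <= F p.1 - iter_delta s * step_size (tau_low s) g p.2 * g ^+ 2
                * (1 - iter_delta s * alphabar R * L / 2).
Proof.
move=> p g dF [Lh d0 _ _] L0 lip js.
have p20 : 0 <= p.2 by exact: inner_Lhat_ge0.
have g0 : 0 <= g by exact: norm2_ge0.
rewrite {1}/inner_state iterS -/(inner_state F s j) -/p /inner_step /= -/g.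
set a := step_size _ _ _; set d := iter_delta s.
have age := step_size_ge (tau_low s) g0 p20.
have ale := step_size_le (tau_low s) g0 p20.
have a0 : 0 <= a by apply: le_trans age; rewrite invr_ge0 exprn_ge0.
have da0 : 0 <= d * a by rewrite mulr_ge0 ?(ltW d0).
have dA : d * a <= d * alphabar R by rewrite ler_wpM2l ?(ltW d0).
apply: (le_trans (descent_step dF lip da0 _)).
  (* The segment stays in C_k: its start is within 10 of theta_k because j has not triggered, and
     its length is at most delta * [alphabar] * [gradsup]. *)
  move=> t /andP[t0 t1]; rewrite /Cset /= -addrA [- _ - _]addrC addrA.
  rewrite (le_trans (ler_norm2D _ _))// lerD ?inner_ball// norm2N norm2Z.
  rewrite ger0_norm ?mulr_ge0 ?(ltW d0)// -/g.
  have gs : g <= gradsup F (iter_theta s).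
    exact: (norm2_grad_le_gradsup (ltW d0) L0 lip (inner_ball js)).
  apply: ler_pM => //; first by rewrite mulr_ge0.
  by apply: le_trans dA; rewrite ler_piMl.
rewrite -/g lerD2l lerN2 ler_wpM2l ?mulr_ge0 ?sqr_ge0 ?(ltW d0)//.
by rewrite lerD2l lerN2 ler_wpM2r ?invr_ge0// ler_wpM2r.
Qed.

(** The first step, taken at theta_k, already gives the whole decrease; by the smallness hypothesis
    the last factor is nonnegative, so later steps do not increase F. *)
Lemma inner_descent (R : realType) (n : nat) (F : 'rV[R]_n -> R)
    (deltabar L : R) (s : outer_state R n) (j : nat) :
  let g := norm2 (grad F (iter_theta s)) in
  (forall y, differentiable F y) -> well_formed F deltabar s -> 0 <= L ->
  lipschitz2_on L (Cset F (iter_theta s) (iter_delta s)) (grad F) ->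
  iter_delta s * alphabar R * L <= 2 ->
  (j < inner_stop F s)%N ->
  F (inner_state F s j.+1).1
    <= F (iter_theta s)
       - iter_delta s * step_size (tau_low s) g (iter_Lhat0 s) * g ^+ 2
                * (1 - iter_delta s * alphabar R * L / 2).
Proof.
move=> g dF wf L0 lip small; elim: j => [|j IH] js.
  exact: (inner_step_descent dF wf L0 lip js).
apply: le_trans (inner_step_descent dF wf L0 lip js) (le_trans _ (IH (ltnW js))).
case: wf => Lh d0 _ _; rewrite gerBl mulr_ge0//; last by lra.
rewrite !mulr_ge0 ?norm2_ge0 ?(ltW d0)//.
apply: le_trans (step_size_ge _ (norm2_ge0 _) (inner_Lhat_ge0 _ _ _)) => //.
Qed.

(** * The outer iteration: invariant, rejection and acceptance *)

Lemma tau_reset (R : realType) (g : R) : 0 < g ->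
  g / Num.sqrt 2 < g < Num.sqrt 20 * (g / Num.sqrt 2).
Proof.
move=> g0; have s20 : 0 < Num.sqrt 2 :> R by rewrite sqrtr_gt0.
rewrite ltr_pdivrMr// ltr_pMr// mulrCA ltr_pMr// ltr_pdivlMr// mul1r.
by rewrite ltr_sqrt// -{1}sqrtr1 ltr_sqrt//; apply/andP; split; lra.
Qed.

Lemma outer_init_well_formed (R : realType) (n : nat) (F : 'rV[R]_n -> R)
    (deltabar delta0 : R) (theta0 : 'rV[R]_n) :
  0 < delta0 <= deltabar -> well_formed F deltabar (outer_init F delta0 theta0).
Proof.
move=> /andP[d0 dd]; split => //=; rewrite -norm2_gt0 => g0.
have /andP[-> /= h] := tau_reset g0.
rewrite mulrC ltr_pMr// -{1}sqrtr1 ltr_sqrt//; lra.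
Qed.

Lemma outer_step_well_formed (R : realType) (n : nat) (F : 'rV[R]_n -> R)
    (rho deltabar : R) (s : outer_state R n) :
  0 < deltabar -> well_formed F deltabar s ->
  well_formed F deltabar (outer_step F rho deltabar s).
Proof.
move=> db0 wf; have [Lh d0 dd tau] := wf.
rewrite /outer_step; case: ifPn => // g0.
have L0 := inner_Lhat_ge0 F (inner_stop F s) Lh.
case: ifP => _; first by split => //=; lra.
have min0 : 0 < Num.min (3 / 2 * iter_delta s) deltabar.
  by rewrite lt_min db0 andbT; lra.
case: ifPn => [_|low].
  by split => //=; rewrite -norm2_gt0; exact: tau_reset.
case: ifPn => [_|upp].
  by split => //=; rewrite ?ge_min ?lexx ?orbT// -norm2_gt0; exact: tau_reset.
by split => //=; rewrite ?ge_min ?lexx ?orbT// !ltNge low upp.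
Qed.

(** If delta * [alphabar] * L < 2 (1 - rho), the last factor in [inner_descent] exceeds rho and the
    rejection test fails. On acceptance alpha_0 is replaced by its lower bound 10^-16, and delta
    cannot shrink because it is already at most [deltabar]. *)
Lemma outer_stepP (R : realType) (n : nat) (F : 'rV[R]_n -> R)
    (rho deltabar : R) (s : outer_state R n) :
  let s' := outer_step F rho deltabar s in
  let th := iter_theta s in
  let de := iter_delta s in
  (forall y, differentiable F y) -> 0 < rho < 1 ->
  well_formed F deltabar s -> grad F th != 0 ->
  [/\ iter_theta s' = th, iter_delta s' = de / 2 &
      forall L, 0 <= L -> lipschitz2_on L (Cset F th de) (grad F) ->
        2 * (1 - rho) <= de * alphabar R * L]
  \/ F (iter_theta s')
       < F th - rho * 10 ^- 16 * de * norm2 (grad F th) ^+ 2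
     /\ de <= iter_delta s'.
Proof.
move=> s' th de dF /andP[rho0 rho1] wf gth0; have [Lh d0 dd tau] := wf.
rewrite /s' /outer_step (negbTE gth0) -/th -/de; set psi := (inner_state _ _ _).1.
set g := norm2 (grad F th); set a := step_size _ _ _.
have g0 : 0 < g by rewrite norm2_gt0.
have age : 10 ^- 16 <= a by apply: step_size_ge => //; exact: ltW.
have a0 : 0 < a by apply: lt_le_trans age; rewrite invr_gt0 exprn_gt0.
case: ifP => [rej|/negbT].
  left; split => //=; first by rewrite mulrC.
  move=> L L0 lip; rewrite leNgt; apply/negP => small.
  have stop0 := inner_stop_gt0 wf gth0.
  have small2 : iter_delta s * alphabar R * L <= 2 by rewrite -/de; lra.
  have js : ((inner_stop F s).-1 < inner_stop F s)%N by rewrite prednK.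
  have := inner_descent dF wf L0 lip small2 js.
  rewrite prednK// -/psi -/th -/de -/g -/a => dec.
  have c : rho < 1 - de * alphabar R * L / 2 by lra.
  have q0 : 0 < de * a * g ^+ 2 by rewrite !mulr_gt0// exprn_gt0.
  move: rej; rewrite leNgt => /negP; apply.
  apply: le_lt_trans dec _; rewrite ltrD2l ltrN2.
  by rewrite -2!(mulrA rho) mulrC ltr_pM2l.
rewrite -ltNge => acc; right.
have dec : F psi < F th - rho * 10 ^- 16 * de * g ^+ 2.
  apply: lt_le_trans acc _; rewrite lerD2l lerN2 ler_wpM2r ?sqr_ge0//.
  by rewrite mulrAC ler_wpM2l// mulr_ge0 ?ltW.
have min0 : de <= Num.min (3 / 2 * de) deltabar.
  by rewrite le_min dd andbT /de; lra.
by case: ifP => _; [|case: ifP => _].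
Qed.

(** * Indices of accepted iterates *)

Lemma next_changeP (R : realType) (n : nat) (th : nat -> 'rV[R]_n) (l : nat) :
  (exists k, (l < k)%N && (th k != th l)) ->
  exists m, [/\ next_change th l = Some m, (l < m)%N, th m != th l &
    forall k, (l <= k < m)%N -> th k = th l].
Proof.
move=> ex; rewrite /next_change; case: pselect => // ex'.
case: ex_minnP => m /andP[lm thm] mmin; exists m; split => // k /andP[].
rewrite leq_eqVlt => /predU1P[-> //|lk] km; apply/eqP/negPn/negP => thk.
by have := mmin k; rewrite lk thk => /(_ isT); rewrite leqNgt km.
Qed.

(** Passing from k to k+1 either prolongs the current block of equal iterates or starts a new one at
    the next accepted index. This carries a stationary point found at any k to an accepted index. *)
Lemma accepted_before (R : realType) (n : nat) (th : nat -> 'rV[R]_n) (k : nat) :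
  exists t l, [/\ accepted th t = Some l, (l <= k)%N &
    forall j, (l <= j <= k)%N -> th j = th l].
Proof.
elim: k => [|k [t [l [tl lk thl]]]].
  by exists 0%N, 0%N; split => // -[].
have [thk|thk] := eqVneq (th k.+1) (th l).
  exists t, l; split => //; first exact: leqW.
  move=> j /andP[lj]; rewrite leq_eqVlt => /predU1P[-> //|jk].
  by apply: thl; rewrite lj.
have /next_changeP[m [eqm lm thm lem]] : exists k, (l < k)%N && (th k != th l).
  by exists k.+1; rewrite ltnS lk.
have mk : m = k.+1.
  apply/eqP; rewrite eqn_leq; apply/andP; split; rewrite leqNgt; apply/negP => h.
    by move: thk; rewrite (lem k.+1) ?eqxx// (leqW lk).
  by move: thm; rewrite (thl m) ?eqxx// (ltnW lm).
exists t.+1, k.+1; split => //=; first by rewrite tl /= eqm mk.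
by move=> j /andP[a b]; congr th; apply/eqP; rewrite eqn_leq b a.
Qed.

Lemma accepted_total (R : realType) (n : nat) (th : nat -> 'rV[R]_n) :
  (forall l, exists k, (l < k)%N && (th k != th l)) ->
  exists l : nat -> nat, [/\ forall t, accepted th t = Some (l t),
    forall t, (l t < l t.+1)%N, forall t, th (l t.+1) != th (l t) &
    forall t k, (l t <= k < l t.+1)%N -> th k = th (l t)].
Proof.
(* The default 0 is never taken: [acc] shows that every value is finite. *)
move=> ex; exists (fun t => odflt 0%N (accepted th t)).
have next t := next_changeP (ex (odflt 0%N (accepted th t))).
have acc t : accepted th t = Some (odflt 0%N (accepted th t)).
  by elim: t => //= t -> /=; have [m [-> _ _ _]] := next t.
by split => // t; rewrite /= [accepted th t]acc /=; have [m [-> lm thm mth]] := next t.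
Qed.

(** * Lower limits and infinite index sets *)

Lemma limn_einf_ge (R : realType) (u : nat -> R) (c : R) (N : nat) :
  (forall k, (N <= k)%N -> c <= u k) -> (c%:E <= limn_einf (EFin \o u))%E.
Proof.
move=> cu; rewrite limn_einf_lim.
rewrite (cvg_lim _ (@cvg_einfs_sup _ (EFin \o u)))//.
apply: le_ereal_sup_tmp; exists (einfs (EFin \o u) N); first by exists N.
by apply: le_ereal_inf_tmp => _ [k /= Nk <-]; rewrite lee_fin; exact: cu.
Qed.

Lemma limn_einf_gt0 (R : realType) (u : nat -> R) :
  (0 < limn_einf (EFin \o u))%E ->
  exists c N, 0 < c /\ forall k, (N <= k)%N -> c <= u k.
Proof.
rewrite limn_einf_lim (cvg_lim _ (@cvg_einfs_sup _ (EFin \o u)))//.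
move=> /ereal_sup_gt[_ [N _ <-]] pos.
have lb k : (N <= k)%N -> (einfs (EFin \o u) N <= (u k)%:E)%E.
  by move=> Nk; apply: ereal_inf_lbound; exists k.
(* The value [-oo] contradicts positivity, and [+oo] is excluded because the terms are finite. *)
move: pos lb; case: (einfs _ N) => [c||//] pos lb.
  by exists c, N; split => // k /lb; rewrite lee_fin.
by have := lb N (leqnn N).
Qed.

Lemma infinite_set_unbounded (A : set nat) :
  (forall M, exists2 t, (M <= t)%N & A t) -> infinite_set A.
Proof.
move=> unb /finite_fsetP[X AX].
have [t Mt At] := unb (\max_(i <- finmap.enum_fset X) i).+1.
have tX : t \in finmap.enum_fset X by move: At; rewrite AX.
by have := @leq_bigmax_seq _ _ xpredT id t tX isT; rewrite leqNgt Mt.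
Qed.

(** * Convergence analysis for abstract sequences *)

(** All that the convergence argument retains of the algorithm; thresholds and inner loop no longer
    appear. The theorem takes c = rho * 10^-16. *)
Definition reject_or_descend (R : realType) (n : nat) (F : 'rV[R]_n -> R)
    (rho c : R) (th : nat -> 'rV[R]_n) (de : nat -> R) : Prop :=
  forall k,
  [/\ th k.+1 = th k, de k.+1 = de k / 2 &
      forall L, 0 <= L -> lipschitz2_on L (Cset F (th k) (de k)) (grad F) ->
        2 * (1 - rho) <= de k * alphabar R * L]
  \/ F (th k.+1) < F (th k) - c * de k * norm2 (grad F (th k)) ^+ 2
     /\ de k <= de k.+1.

Lemma value_nonincreasing (R : realType) (n : nat) (F : 'rV[R]_n -> R)
    (rho c : R) (th : nat -> 'rV[R]_n) (de : nat -> R) :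
  reject_or_descend F rho c th de -> 0 < c -> (forall k, 0 < de k) ->
  {homo F \o th : i j / (i <= j)%N >-> j <= i}.
Proof.
move=> H c0 de0; apply: homo_leq => [x|y x z xy yz|k]; first exact: lexx.
  exact: le_trans yz xy.
case: (H k) => [[/= -> //]|[/= /ltW dec _]]; apply: le_trans dec _.
by rewrite gerBl !mulr_ge0 ?norm2_ge0 ?ltW.
Qed.

(** On a constant tail the strict decrease of an acceptance is impossible, so every step is a
    rejection and delta is halved forever. The sets C_k shrink with delta, so the same L serves
    throughout and bounds delta below, a contradiction. *)
Lemma change_infinitely_often (R : realType) (n : nat) (F : 'rV[R]_n -> R)
    (rho c L : R) (th : nat -> 'rV[R]_n) (de : nat -> R) (N : nat) :
  reject_or_descend F rho c th de -> 0 < c -> (forall k, 0 < de k) ->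
  rho < 1 -> 0 <= L -> lipschitz2_on L (Cset F (th N) (de N)) (grad F) ->
  exists2 k, (N <= k)%N & th k.+1 != th k.
Proof.
move=> H c0 de0 rho1 L0 lip; apply: contrapT => /forall2NP noch.
have same i : th (N + i).+1%N = th (N + i)%N.
  by have := noch (N + i)%N; rewrite leq_addr => -[//|/negP/negPn/eqP].
have rej i : de (N + i).+1%N = de (N + i)%N / 2 /\
    forall L, 0 <= L ->
      lipschitz2_on L (Cset F (th (N + i)%N) (de (N + i)%N)) (grad F) ->
      2 * (1 - rho) <= de (N + i)%N * alphabar R * L.
  case: (H (N + i)%N) => [[_ -> ]//|[]]; rewrite same => dec _.
  have : 0 <= c * de (N + i)%N * norm2 (grad F (th (N + i)%N)) ^+ 2.
    by rewrite !mulr_ge0 ?norm2_ge0 ?ltW.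
  by move: dec; lra.
have thN i : th (N + i)%N = th N.
  by elim: i => [|i IH]; rewrite ?addn0// addnS same.
(* Decay like 1/(i+1), weaker than 2^-i, is enough and matches the Archimedean bound. *)
have deN i : de (N + i)%N * i.+1%:R <= de N.
  elim: i => [|i IH]; first by rewrite addn0 mulr1.
  rewrite addnS (rej i).1; apply: le_trans IH.
  rewrite -mulrA ler_wpM2l ?(ltW (de0 _))// -[i.+2%:R]natr1 -[i.+1%:R]natr1.
  have : 0 <= i%:R :> R by []. lra.
(* A rejection at N + i forces i + 1 <= y. *)
set y := de N * alphabar R * L / (2 * (1 - rho)).
have r0 : 0 < 2 * (1 - rho) by lra.
have A0 := ltW (alphabar_gt0 R).
have y0 : 0 <= y by rewrite !mulr_ge0 ?invr_ge0 ?(ltW (de0 _)) ?(ltW r0).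
have := archi_boundP y0; set i := Num.Def.archi_bound y => yi.
have deNi : de (N + i)%N <= de N.
  by apply: le_trans (deN i); rewrite ler_peMr ?(ltW (de0 _))// ler1n.
have lipi : lipschitz2_on L (Cset F (th (N + i)%N) (de (N + i)%N)) (grad F).
  by rewrite thN; apply: lipschitz2_onS lip; exact: subset_Cset.
have big : 2 * (1 - rho) * i.+1%:R <= de N * alphabar R * L.
  apply: le_trans (_ : de (N + i)%N * alphabar R * L * i.+1%:R <= _).
    by rewrite ler_wpM2r//; exact: (rej i).2.
  by rewrite -!mulrA [L * _]mulrC !mulrA ler_wpM2r// mulrAC ler_wpM2r.
have : y < y; last by rewrite ltxx.
apply: lt_le_trans yi _; rewrite ler_pdivlMr// mulrC; apply: le_trans big.
by rewrite ler_wpM2l ?(ltW r0)// ler_nat.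
Qed.

(** The values F(theta_k) decrease to a limit, so each late acceptance lowers F only slightly, and
    this decrease dominates c * d times the squared gradient norm. *)
Lemma grad_cvg0 (R : realType) (n : nat) (F : 'rV[R]_n -> R)
    (rho c d : R) (th : nat -> 'rV[R]_n) (de : nat -> R) (N : nat) :
  reject_or_descend F rho c th de -> 0 < c -> (forall k, 0 < de k) ->
  has_lbound (range F) ->
  (forall M, exists2 k, (M <= k)%N & th k.+1 != th k) ->
  0 < d -> (forall k, (N <= k)%N -> d <= de k) ->
  norm2 (grad F (th k)) @[k --> \oo] --> (0 : R).
Proof.
move=> H c0 de0 [m lbF] ch d0 dN.
have Fcvg : cvgn (F \o th).
  apply: nonincreasing_is_cvgn; first exact: value_nonincreasing H c0 de0.
  by exists m => _ [k _ <-]; apply: lbF; exists (th k).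
apply/cvgrPdist_lt => e e0.
(* Two values within this distance of the limit differ by less than c * d * e^2. *)
have e'0 : 0 < c * d * e ^+ 2 / 2 by rewrite !mulr_gt0 ?exprn_gt0.
have /cvgrPdist_lt/(_ _ e'0)[M _ FM] := Fcvg.
exists (maxn M N) => // k /=; rewrite geq_max => /andP[Mk Nk].
(* The first change at or after k is an acceptance at the same point, so the gradient at k can be
   estimated there. *)
have [k' [kk' thk' chk']] : exists k', [/\ (k <= k')%N, th k' = th k &
    th k'.+1 != th k'].
  have ex : exists j, (k <= j)%N && (th j.+1 != th j).
    by have [j kj chj] := ch k; exists j; rewrite kj.
  case: (ex_minnP ex) => j /andP[kj chj] jmin; exists j; split => //.
  suff same i : (k + i <= j)%N -> th (k + i)%N = th k.
    by rewrite -(subnKC kj) same// subnKC.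
  elim: i => [|i IH]; rewrite ?addn0// addnS => kij.
  rewrite -(IH (ltnW kij)); apply/eqP/negPn/negP => h.
  by have := jmin (k + i)%N; rewrite leq_addr h leqNgt kij => /(_ isT).
rewrite sub0r normrN ger0_norm ?norm2_ge0// -thk'.
rewrite -(@ltr_pXn2r _ 2) ?nnegrE ?norm2_ge0 ?(ltW e0)//.
case: (H k') => [[same]|[dec _]]; first by rewrite same eqxx in chk'.
have h1 := FM k' (leq_trans Mk kk').
have h2 := FM k'.+1 (leqW (leq_trans Mk kk')).
move: h1 h2; rewrite /= !ltr_norml => /andP[h1 h1'] /andP[h2 h2'].
set g := norm2 _ ^+ 2 in dec *.
have : c * d * g <= c * de k' * g.
  by rewrite ler_wpM2r ?sqr_ge0// ler_wpM2l ?(ltW c0)// dN// (leq_trans Nk).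
move=> h3; rewrite -(ltr_pM2l (mulr_gt0 c0 d0)); lra.
Qed.

(** The dominating differences are nonnegative, so the sum may be extended from T to all indices,
    where it telescopes. *)
Lemma esum_telescope_le (R : realType) (T : set nat) (a v : nat -> R) (K m : R) :
  0 <= K -> (forall t, v t.+1 <= v t) -> (forall t, m <= v t) ->
  (forall t, T t -> (0 < t)%N) ->
  (forall t, T t -> a t <= K * (v t.-1 - v t)) ->
  (\esum_(t in T) (a t)%:E <= (K * (v 0%N - m))%:E)%E.
Proof.
move=> K0 vdec vm T0 av.
have b0 t : (0 <= (K * (v t.-1 - v t))%:E)%E.
  rewrite lee_fin mulr_ge0//; case: t => [|t]; rewrite subr_ge0//=.
apply: (@le_trans _ _ (\esum_(t in setT) (K * (v t.-1 - v t))%:E)%E).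
  rewrite esum_mkcond; apply: le_esum => t _; case: ifP => [/set_mem Tt|_] //.
  by rewrite lee_fin; exact: av.
rewrite -nneseries_esumT//; apply: lime_le.
  by apply: is_cvg_nneseries => t _ _; exact: b0.
apply: nearW => k; rewrite sumEFin lee_fin -mulr_sumr ler_wpM2l//.
case: k => [|k]; first by rewrite big_geq// subr_ge0.
(* At t = 0 the truncated predecessor is 0, so that term vanishes. *)
rewrite big_nat_recl//= subrr add0r.
have -> : \sum_(0 <= i < k) (v i - v i.+1) = v 0%N - v k.
  rewrite -[RHS]opprB -telescope_sumr// -sumrN.
  by apply: eq_bigr => i _; rewrite opprB.
by rewrite lerD2l lerN2.
Qed.

(* The last step of a block of equal iterates that contains a rejection has a
   step factor at least half of one too large to be accepted, which is of order
   1/L. *)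
Lemma block_descent (R : realType) (n : nat) (F : 'rV[R]_n -> R)
    (rho c L : R) (th : nat -> 'rV[R]_n) (de : nat -> R) (a b : nat) :
  reject_or_descend F rho c th de -> 0 < c -> (forall k, 0 < de k) ->
  rho < 1 -> 0 < L -> lipschitz2_on L (Cset F (th a) (de a)) (grad F) ->
  (a.+1 < b)%N -> (forall k, (a <= k < b)%N -> th k = th a) -> th b != th a ->
  norm2 (grad F (th a)) ^+ 2 / L
    <= alphabar R / (c * (1 - rho)) * (F (th a) - F (th b)).
Proof.
move=> H c0 de0 rho1 L0 lip; case: b => [//|[//|k]]; rewrite !ltnS => ak tha thb.
(* Here b = k + 2: the steps a, ..., k leave the iterate fixed and hence are rejections. *)
have rej j : (a <= j <= k)%N -> [/\ th j.+1 = th j, de j.+1 = de j / 2 &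
      forall L, 0 <= L -> lipschitz2_on L (Cset F (th j) (de j)) (grad F) ->
        2 * (1 - rho) <= de j * alphabar R * L].
  move=> /andP[aj jk]; case: (H j) => [//|[dec _]]; exfalso; move: dec.
  rewrite !tha ?aj ?ltnS ?(leqW jk) ?jk ?(leqW aj)// => dec.
  have : 0 <= c * de j * norm2 (grad F (th a)) ^+ 2.
    by rewrite !mulr_ge0 ?norm2_ge0 ?ltW.
  by move: dec; lra.
have dea i : (a + i <= k)%N -> de (a + i)%N <= de a.
  elim: i => [|i IH]; rewrite ?addn0// addnS => aik.
  have aik' : (a <= a + i <= k)%N by rewrite leq_addr ltnW.
  have [_ -> _] := rej _ aik'.
  apply: le_trans (IH (ltnW aik)); have := de0 (a + i)%N; lra.
have akk : (a <= k <= k)%N by rewrite ak leqnn.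
have [_ dek Lk] := rej k akk.
have thk : th k = th a by apply: tha; rewrite ak/= ltnW.
have thk1 : th k.+1 = th a by apply: tha; rewrite (leqW ak) leqnn.
have lipk : lipschitz2_on L (Cset F (th a) (de k)) (grad F).
  apply: lipschitz2_onS lip; apply: subset_Cset.
  by rewrite -{1}(subnKC ak) dea// subnKC.
have large : 2 * (1 - rho) <= de k * alphabar R * L.
  by apply: Lk (ltW L0) _; rewrite thk.
(* Step k + 1 changes the iterate, so it is an acceptance, with delta equal to half of the value
   rejected at k. *)
case: (H k.+1) => [[same]|[dec _]].
  by rewrite same thk1 eqxx in thb.
move: dec; rewrite thk1 dek; set g := norm2 _ ^+ 2 => dec.
have A0 := alphabar_gt0 R.
have r0 : 0 < 1 - rho by lra.
have g0 : 0 <= g by exact: sqr_ge0.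
rewrite ler_pdivrMr// mulrAC [X in X * _]mulrAC mulrAC ler_pdivlMr ?mulr_gt0//.
have D : c * (de k / 2) * g <= F (th a) - F (th k.+2) by lra.
apply: le_trans (_ : (alphabar R * L) * (c * (de k / 2) * g) <= _); last first.
  by rewrite ler_wpM2l// mulr_ge0// ltW.
have large' : (1 - rho) <= de k * alphabar R * L / 2 by lra.
have := ler_wpM2l (mulr_ge0 (ltW c0) g0) large'; lra.
Qed.

(** * Application to the algorithm *)

Lemma outer_well_formed (R : realType) (n : nat) (F : 'rV[R]_n -> R)
    (rho deltabar delta0 : R) (theta0 : 'rV[R]_n) (k : nat) :
  0 < deltabar -> 0 < delta0 <= deltabar ->
  well_formed F deltabar (outer F rho deltabar delta0 theta0 k).
Proof.
move=> db dd; elim: k => [|k IH]; first exact: outer_init_well_formed.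
by rewrite /outer iterS; exact: outer_step_well_formed.
Qed.

(** Serves the case of a vanishing gradient, where the state is frozen and [reject_or_descend]
    fails; hence the separate induction. *)
Lemma value_le_init (R : realType) (n : nat) (F : 'rV[R]_n -> R)
    (rho deltabar delta0 : R) (theta0 : 'rV[R]_n) (k : nat) :
  (forall y, differentiable F y) -> 0 < rho < 1 -> 0 < deltabar ->
  0 < delta0 <= deltabar ->
  F (theta F rho deltabar delta0 theta0 k) <= F theta0.
Proof.
move=> dF rho01 db dd; elim: k => [//|k]; apply: le_trans.
rewrite /theta /outer iterS -/(outer _ _ _ _ _ k).
have wf := outer_well_formed F rho theta0 k db dd; set s := outer _ _ _ _ _ k in wf *.
have [g0|g0] := eqVneq (grad F (iter_theta s)) 0.
  by rewrite /outer_step g0 eqxx.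
case: (outer_stepP dF rho01 wf g0) => [[-> //]|[/ltW dec _]].
apply: le_trans dec _; case: wf rho01 => _ d0 _ _ /andP[rho0 _].
by rewrite gerBl !mulr_ge0 ?norm2_ge0 ?invr_ge0 ?exprn_ge0 ?ltW.
Qed.

Theorem theorem2 (R : realType) (n : nat) (F : 'rV[R]_n -> R)
    (rho deltabar delta0 : R) (theta0 : 'rV[R]_n)
    (Lip : set 'rV[R]_n -> R) :
  let th := theta F rho deltabar delta0 theta0 in
  let de := delta F rho deltabar delta0 theta0 in
  let ell := accepted th in
  let C := fun k => Cset F (th k) (de k) in
  continuous F ->
  has_lbound (range F) ->
  (forall x, differentiable F x) ->
  locally_lipschitz2 (grad F) ->
  0 < rho < 1 ->
  0 < deltabar ->
  0 < delta0 <= deltabar ->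
  (forall k, 0 < Lip (C k) /\ lipschitz2_on (Lip (C k)) (C k) (grad F)) ->
  (exists t l : nat,
      [/\ ell t = Some l, F (th l) <= F theta0 & grad F (th l) = 0])
  \/
  [/\ (forall t, ell t <> None),
      (0 < limn_einf (fun k => (de k)%:E))%E
    & norm2 (grad F (th k)) @[k --> \oo] --> (0 : R)]
  \/
  (exists l : nat -> nat,
    [/\ (forall t, ell t = Some (l t)),
        limn_einf (fun k => (de k)%:E) = 0%E
      & exists T : set nat,
          [/\ infinite_set T, T `<=` [set t | (0 < t)%N]
            & (\esum_(t in T)
                 (norm2 (grad F (th (l t.-1))) ^+ 2 / Lip (C (l t.-1)))%:E
               < +oo)%E]]).
Proof.
move=> th de ell C _ lbF dF _ rho01 db dd LipC.
have [[k gk]|/forallNP gne] := pselect (exists k, grad F (th k) = 0).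
  left; have [t [l [tl lk thl]]] := accepted_before th k.
  exists t, l; split => //; first exact: value_le_init.
  by rewrite -(thl k) ?lk ?leqnn.
right; have /andP[rho0 rho1] := rho01.
have wf k := outer_well_formed F rho theta0 k db dd.
have de0 k : 0 < de k by case: (wf k).
pose c : R := rho * 10 ^- 16.
have c0 : 0 < c by rewrite mulr_gt0// invr_gt0 exprn_gt0.
have H : reject_or_descend F rho c th de.
  by move=> k; apply: (outer_stepP dF rho01 (wf k)); apply/eqP; exact: gne.
have Fmon := value_nonincreasing H c0 de0.
have ch N : exists2 k, (N <= k)%N & th k.+1 != th k.
  have [L0 lip] := LipC N.
  exact: change_infinitely_often H c0 de0 rho1 (ltW L0) lip.
have chl l : exists k, (l < k)%N && (th k != th l).
  have [k lk thk] := ch l; exists k.+1; rewrite ltnS lk/=.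
  (* A change between k and k + 1 could a priori return to theta_l; the strict decrease of F at k
     excludes this. *)
  apply/eqP => same; move: (Fmon _ _ lk); rewrite /= -same.
  case: (H k) => [[e]|[dec _]]; first by rewrite e eqxx in thk.
  have : 0 <= c * de k * norm2 (grad F (th k)) ^+ 2.
    by rewrite !mulr_ge0 ?norm2_ge0 ?ltW.
  by move: dec; lra.
have [l [accl ltl neql thl]] := accepted_total chl.
have [pos|] := ltP 0%E (limn_einf (fun k => (de k)%:E)).
  left; split => //; first by move=> t; rewrite /ell accl.
  have [d [N [d0 dN]]] := limn_einf_gt0 pos.
  exact: grad_cvg0 H c0 de0 lbF ch d0 dN.
move=> inf_le0; have inf0 : limn_einf (fun k => (de k)%:E) = 0%E.
  apply/le_anti; rewrite inf_le0 /=.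
  by apply: (@limn_einf_ge _ de 0 0%N) => k _; exact: ltW.
right; exists l; split => //.
(* These are the t whose preceding block has at least two indices, that is, contains a rejection. *)
exists [set t | (0 < t)%N /\ ((l t.-1).+1 < l t)%N]; split.
(* If no such t existed from M on, every step from l M on would be an acceptance, delta would be
   nondecreasing from there, and its lower limit would be positive. *)
- apply: infinite_set_unbounded => M; apply: contrapT => /forall2NP short.
  have next t : (M <= t)%N -> l t.+1 = (l t).+1.
    move=> Mt; have := short t.+1; rewrite /= (leqW Mt) => -[//|/not_andP[//|]].
    by move=> /negP; rewrite -leqNgt => lel; apply/eqP; rewrite eqn_leq lel ltl.
  have lM i : l (M + i)%N = (l M + i)%N.
    by elim: i => [|i IH]; rewrite ?addn0// addnS next ?leq_addr// IH addnS.
  have deM i : de (l M) <= de (l M + i)%N.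
    elim: i => [|i IH]; rewrite ?addn0// addnS.
    case: (H (l M + i)%N) => [[same]|[_ le]]; last exact: le_trans IH le.
    by move: (neql (M + i)%N); rewrite -addnS !lM addnS same eqxx.
  have : ((de (l M))%:E <= limn_einf (fun k => (de k)%:E))%E.
    apply: (@limn_einf_ge _ de _ (l M)) => k Mk.
    by rewrite -(subnKC Mk).
  by rewrite inf0 lee_fin leNgt de0.
- by move=> t [].
- have [m lbm] := lbF.
  pose K := alphabar R / (c * (1 - rho)).
  apply: (@le_lt_trans _ _ (K * (F (th (l 0%N)) - m))%:E); last exact: ltry.
  apply: (@esum_telescope_le _ _ _ (fun t => F (th (l t)))).
  + rewrite divr_ge0 ?(ltW (alphabar_gt0 R))// mulr_ge0 ?(ltW c0)//; lra.
  + by move=> t; apply: Fmon; exact: ltnW.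
  + by move=> t; apply: lbm; exists (th (l t)).
  + by move=> t [].
  (* The block from l t to l t.+1 is used, with the Lipschitz constant at its first index, where
     delta is largest among its rejections. *)
  + case=> [|t] [//= _ short]; have [L0 lip] := LipC (l t).
    exact: block_descent H c0 de0 rho1 L0 lip short (thl t) (neql t).
Qed.
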